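(* Let $f\in \mathcal{C}_1$. Then $$\mathcal{J}[f] = \frac{1}{\pi} + \frac{1}{\pi} \int_0^\infty \frac{(f-\varphi_{r_f})^2(x)}{\varphi_{r_f}(x)}\, \mathrm{d}x,$$ where $r_f>0$ is given by $$r_f^2 := \left( \int_0^\infty f^2(x)\, \mathrm{d}x \right) \left( \int_0^\infty x^2 f^2(x)\, \mathrm{d}x \right)^{-1}.$$
   Context: Functions are real-valued on $(0,\infty)$ and identified when they agree almost everywhere. Let $$\mathcal{C}_1 := \left\{ f\in L^2((0,\infty),(1+x^2)\, \mathrm{d}x)\ : \ f\ge 0 \text{ a.e. and } \|f\|_{L^1((0,\infty))}=1 \right\}.$$ For $z>0$ define $$\varphi_z(x) := \frac{2}{\pi} \frac{z}{1+z^2 x^2}, \qquad x\in (0,\infty).$$ For $f\in\mathcal{C}_1$, $$\mathcal{J}[f] := \left( \int_0^\infty f^2(x)\, \mathrm{d}x \right)^{1/2} \left( \int_0^\infty x^2 f^2(x)\, \mathrm{d}x \right)^{1/2}.$$ *)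

(* Defs.v *)
From mathcomp Require Import all_boot all_order all_algebra.
From mathcomp Require Import all_classical all_reals all_analysis.

Set Implicit Arguments.
Unset Strict Implicit.
Unset Printing Implicit Defensive.

Import Order.TTheory GRing.Theory Num.Theory.
Import numFieldNormedType.Exports.

Local Open Scope classical_set_scope.
Local Open Scope ring_scope.

(* Functions on (0, oo) are represented by total functions R -> R whose values
   outside (0, oo) are irrelevant; a.e. classes are represented by their
   Borel-measurable representatives. *)
Definition halfline (R : realType) : set R := `]0, +oo[.
Arguments halfline {R}.

(* The second conjunct is square-integrability with respect to the weighted
   measure (1 + x^2) dx. *)
Definition C1 (R : realType) : set (R -> R) :=
  [set f : R -> R |
    [/\ measurable_fun halfline f,
        (@lebesgue_measure R).-integrable halfline
          (fun x => (f x ^+ 2 * (1 + x ^+ 2))%:E),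
        (\forall x \ae (@lebesgue_measure R), halfline x -> 0 <= f x) &
        (\int[@lebesgue_measure R]_(x in halfline) `|f x|%:E = 1)%E]].

Definition phi (R : realType) (z x : R) : R :=
  2 / pi * (z / (1 + z ^+ 2 * x ^+ 2)).

(* On C1 both integrands below are dominated by f^2 (1 + x^2), hence these
   real-valued integrals are the genuine (finite) ones. *)
Definition int_sq (R : realType) (f : R -> R) : R :=
  \int[@lebesgue_measure R]_(x in halfline) (f x ^+ 2).

Definition int_x2sq (R : realType) (f : R -> R) : R :=
  \int[@lebesgue_measure R]_(x in halfline) (x ^+ 2 * f x ^+ 2).

Definition J (R : realType) (f : R -> R) : R :=
  Num.sqrt (int_sq f) * Num.sqrt (int_x2sq f).

Definition rf (R : realType) (f : R -> R) : R :=
  Num.sqrt (int_sq f * (int_x2sq f)^-1).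

(* Main.v *)
(* Expanding the square, (f - phi_z)^2 / phi_z = f^2 / phi_z - 2 f + phi_z, where
   1 / phi_z = (pi / 2) (1 / z + z x^2) and both f and phi_z have integral 1.
   Hence its integral is (pi / 2) (A / z + z B) - 1 with A and B the integrals of
   f^2 and x^2 f^2, and for z = sqrt (A / B) both terms in the parenthesis equal
   sqrt A * sqrt B. *)
Require Import Defs.
From mathcomp Require Import all_boot all_order all_algebra.
From mathcomp Require Import all_classical all_reals all_analysis.
From mathcomp Require Import measurable_realfun ring.

Import Order.TTheory GRing.Theory Num.Theory.
Import numFieldNormedType.Exports.

Local Open Scope classical_set_scope.
Local Open Scope ring_scope.

Lemma measurable_halfline (R : realType) :
  measurable (halfline : set (measurableTypeR R)).
Proof. exact: measurable_itv. Qed.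
#[local] Hint Extern 0 (measurable _) =>
  solve [apply: measurable_halfline] : core.

Lemma phi_gt0 {R : realType} (z x : R) : 0 < z -> 0 < phi z x.
Proof.
move=> z0; rewrite /phi mulr_gt0 ?divr_gt0 ?pi_gt0//.
by rewrite ltr_pwDl// mulr_ge0 ?sqr_ge0.
Qed.

Lemma continuous_phi {R : realType} (z : R) : continuous (phi z).
Proof.
move=> x; rewrite /phi.
apply: cvgM; first exact: cvg_cst.
apply: cvgM; first exact: cvg_cst.
apply: cvgV; first by rewrite gt_eqF// ltr_pwDl// mulr_ge0 ?sqr_ge0.
apply: cvgD; first exact: cvg_cst.
apply: cvgM; first exact: cvg_cst.
exact: (@exprn_continuous R 2 x).
Qed.

Lemma measurable_phi {R : realType} (D : set R) (z : R) :
  measurable_fun D (phi z).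
Proof.
apply: measurable_funTS; apply: continuous_measurable_fun.
exact: continuous_phi.
Qed.

(** An arctangent primitive of [phi z], valid on the whole line and for every [z]; it serves to
    compute the total mass of [phi z]. *)
Lemma is_derive_phi {R : realType} (z x : R) :
  is_derive x 1 (fun t => 2 / pi * atan (z * t)) (phi z x).
Proof.
have dl : is_derive x 1 ( *%R z) z.
  by apply: is_derive_eq; rewrite /GRing.scale/= mulr1.
have da := is_derive1_comp (is_derive1_atan (z * x)) dl.
apply: (is_derive_eq (is_deriveZ (2 / pi) da)).
by rewrite /phi /GRing.scale/= exprMn [_^-1 * z]mulrC.
Qed.

(** The primitive [2 / pi * atan (z * t)] rises from 0 at [t = 0] to [2 / pi * (pi / 2) = 1] at
    infinity, the limit using [z > 0]. *)
Lemma integral_phi {R : realType} (z : R) : 0 < z ->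
  (\int[@lebesgue_measure R]_(x in halfline) (phi z x)%:E = 1)%E.
Proof.
(* Adding the null set {0} gives the interval closed at 0 on which the fundamental theorem of
   calculus is applied. *)
move=> z0; rewrite /halfline integral_itv_obnd_cbnd; last first.
  by apply/measurable_EFinP; exact: measurable_phi.
have cF (x : R) : {for x, continuous (fun t => 2 / pi * atan (z * t))}.
  apply: differentiable_continuous; apply/derivable1_diffP.
  by have [] := is_derive_phi z x.
rewrite (@ge0_continuous_FTC2y _ _ (fun t => 2 / pi * atan (z * t)) _ 1).
- by rewrite mulr0 atan0 mulr0 sube0.
- by move=> x _; exact/ltW/phi_gt0.
- exact/continuous_subspaceT/continuous_phi.
- rewrite [X in _ --> X](_ : _ = 2 / pi * (pi / 2)); last first.
    by rewrite mulrA divfK ?divff// gt_eqF// pi_gt0.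
  apply: cvgM; first exact: cvg_cst.
  exact: (cvg_comp _ _ (gt0_cvgMry z0 cvg_id) (@cvgy_atan R)).
- by move=> x _; have [] := is_derive_phi z x.
- by apply: cvg_at_right_filter; exact: cF.
- by move=> x _; rewrite derive1E; have [_ ->] := is_derive_phi z x.
Qed.

Lemma integrable_phi {R : realType} (z : R) : 0 < z ->
  (@lebesgue_measure R).-integrable halfline (EFin \o phi z).
Proof.
move=> z0; apply/integrableP; split.
  by apply/measurable_EFinP; exact: measurable_phi.
under eq_integral => x _ do rewrite /= ger0_norm ?ltW ?phi_gt0//.
by rewrite integral_phi// ltry.
Qed.

Section C1_theory.
Context {R : realType} (f : R -> R) (hf : C1 f).
Let mu := @lebesgue_measure R.

Let mf : measurable_fun halfline f. Proof. by case: hf. Qed.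

Lemma C1_measurable_sq : measurable_fun halfline (fun x => f x ^+ 2).
Proof. exact: measurable_funX. Qed.

Lemma C1_measurable_x2sq : measurable_fun halfline (fun x => x ^+ 2 * f x ^+ 2).
Proof.
by apply: measurable_funM; apply: measurable_funX.
Qed.

(** Domination by the weighted square [f x ^+ 2 * (1 + x ^+ 2)]; the same bound serves for
    [x ^+ 2 * f x ^+ 2] below. *)
Lemma C1_integrable_sq : mu.-integrable halfline (EFin \o (fun x => f x ^+ 2)).
Proof.
case: hf => _ i _ _; apply: le_integrable i => //.
  by apply/measurable_EFinP; exact: C1_measurable_sq.
move=> x _; have x2 := sqr_ge0 x; have f2 := sqr_ge0 (f x).
have w0 : 0 <= f x ^+ 2 * (1 + x ^+ 2) by apply: mulr_ge0 => //; exact: addr_ge0.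
by rewrite /= lee_fin !ger0_norm// ler_peMr// lerDl.
Qed.

Lemma C1_integrable_x2sq :
  mu.-integrable halfline (EFin \o (fun x => x ^+ 2 * f x ^+ 2)).
Proof.
case: hf => _ i _ _; apply: le_integrable i => //.
  by apply/measurable_EFinP; exact: C1_measurable_x2sq.
move=> x _; have x2 := sqr_ge0 x; have f2 := sqr_ge0 (f x).
have v0 : 0 <= x ^+ 2 * f x ^+ 2 by exact: mulr_ge0.
have w0 : 0 <= f x ^+ 2 * (1 + x ^+ 2) by apply: mulr_ge0 => //; exact: addr_ge0.
by rewrite /= lee_fin !ger0_norm// mulrC ler_wpM2l// lerDr.
Qed.

Lemma C1_integrable : mu.-integrable halfline (EFin \o f).
Proof.
case: hf => _ _ _ f1; apply/integrableP; split; first exact/measurable_EFinP.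
by rewrite f1 ltry.
Qed.

(** [C1] normalises the integral of [|f|], which agrees with [f] almost everywhere because [f] is
    nonnegative there. *)
Lemma C1_Rintegral : \int[mu]_(x in halfline) f x = 1.
Proof.
case: hf => _ _ f0 f1; rewrite /Rintegral -[1]/(fine 1%E) -f1; congr fine.
apply: ae_eq_integral => //.
- exact/measurable_EFinP.
- by apply/measurable_EFinP; exact: measurableT_comp.
- move: f0; apply: (@filterS _ _ (ae_filter_ringOfSetsType mu)) => x fx hx.
  by rewrite ger0_norm ?fx.
Qed.

(* A function of norm 1 cannot vanish almost everywhere. *)
Lemma C1_Rintegral_gt0 (g : R -> R) :
  mu.-integrable halfline (EFin \o g) -> (forall x, 0 <= g x) ->
  (forall x, halfline x -> g x = 0 -> f x = 0) ->
  0 < \int[mu]_(x in halfline) g x.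
Proof.
move=> ig g0 gf; rewrite lt_neqAle Rintegral_ge0// andbT.
apply/eqP => I0; case: hf => _ _ _ f1.
(* A nonnegative function of zero integral vanishes a.e.; [gf] then passes this on to [f], against
   the norm being 1. *)
have g_eq0 : ae_eq mu halfline (EFin \o g) (cst 0%E).
  apply/ae_eq_integral_abs => //; first exact: (measurable_int mu).
  under eq_integral do rewrite /= ger0_norm//.
  by rewrite -(fineK (integrable_fin_num _ ig))// -[fine _]I0.
have f_eq0 : ae_eq mu halfline (EFin \o f) (cst 0%E).
  move: g_eq0; apply: (@filterS _ _ (ae_filter_ringOfSetsType mu)) => x gx hx.
  by move: (gx hx) => /= -[/(gf _ hx) ->].
have /(ae_eq_integral_abs mu) := f_eq0.
rewrite [X in X = _]f1 => /(_ _ _)/eqP; rewrite onee_eq0.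
by move=> h; suff: false by []; apply: h => //; exact/measurable_EFinP.
Qed.

Lemma C1_int_sq_gt0 : 0 < int_sq f.
Proof.
apply: C1_Rintegral_gt0 C1_integrable_sq _ _ => x; first exact: sqr_ge0.
by move=> _ /eqP; rewrite sqrf_eq0 => /eqP.
Qed.

(** Together with [C1_int_sq_gt0], this makes the quotient under the root in [rf] a genuine positive
    number, not the default value of a division by 0. *)
Lemma C1_int_x2sq_gt0 : 0 < int_x2sq f.
Proof.
apply: C1_Rintegral_gt0 C1_integrable_x2sq _ _ => x.
  by rewrite mulr_ge0 ?sqr_ge0.
(* Here [x > 0], so the factor [x ^+ 2] can be cancelled. *)
rewrite /halfline/= in_itv/= andbT => x0 /eqP.
by rewrite mulf_eq0 !sqrf_eq0 gt_eqF//= => /eqP.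
Qed.

(** Stated for the extended-real integral, so that finiteness of the deviation is part of the
    claim. *)
Lemma C1_integral_deviation (z : R) : 0 < z ->
  (\int[mu]_(x in halfline) ((f x - phi z x) ^+ 2 / phi z x)%:E =
   (pi / 2 * (int_sq f / z + z * int_x2sq f) - 1)%:E)%E.
Proof.
move=> z0.
have pi0 : pi != 0 :> R by rewrite gt_eqF// pi_gt0.
(* The coefficients in [1 / phi z x = c1 + c2 * x ^+ 2]. *)
pose c1 : R := pi / 2 / z; pose c2 : R := pi / 2 * z.
have devE x : (f x - phi z x) ^+ 2 / phi z x =
    c1 * f x ^+ 2 + c2 * (x ^+ 2 * f x ^+ 2) + (-2 * f x + phi z x).
  rewrite /phi /c1 /c2; move: pi pi0 => p p0; field.
  by rewrite p0 [z == 0]gt_eqF// gt_eqF// ltr_pwDl// sqr_ge0.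
have iZ (c : R) (g : R -> R) : mu.-integrable halfline (EFin \o g) ->
    mu.-integrable halfline (EFin \o (fun x => c * g x)).
  by move=> ig; exact: (integrableZl (measurable_halfline R) c ig).
have iD (g h : R -> R) : mu.-integrable halfline (EFin \o g) ->
    mu.-integrable halfline (EFin \o h) ->
    mu.-integrable halfline (EFin \o (fun x => g x + h x)).
  by move=> ig ih; exact: (integrableD (measurable_halfline R) ig ih).
have j1 := C1_integrable_sq; have i1 := iZ c1 _ j1.
have j2 := C1_integrable_x2sq; have i2 := iZ c2 _ j2.
have j3 := C1_integrable; have i3 := iZ (-2) _ j3.
have i4 := integrable_phi z z0.
under eq_integral do rewrite devE.
have i := iD _ _ (iD _ _ i1 i2) (iD _ _ i3 i4).
(* Integrability of the sum makes its integral finite, so linearity can be applied to real-valued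
   integrals. *)
rewrite -(fineK (integrable_fin_num _ i))//; congr (_%:E).
rewrite -[LHS]/(\int[mu]_(x in halfline) _) RintegralD//; [|exact: iD..].
rewrite RintegralD// RintegralD//.
have mD := measurable_halfline R.
rewrite (RintegralZl c1 mD j1) (RintegralZl c2 mD j2) (RintegralZl (-2) mD j3).
have phi1 : \int[mu]_(x in halfline) phi z x = 1.
  by rewrite /Rintegral integral_phi.
rewrite C1_Rintegral phi1.
rewrite -/(int_sq f) -/(int_x2sq f) /c1 /c2; move: pi => p.
by field; rewrite gt_eqF.
Qed.

End C1_theory.

Theorem proposition1p2 (R : realType) (f : R -> R) (hf : C1 f) :
  [/\ 0 < rf f,
      rf f ^+ 2 = int_sq f * (int_x2sq f)^-1 &
      ((J f)%:E = (pi^-1)%:E + (pi^-1)%:E *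
        \int[@lebesgue_measure R]_(x in halfline)
          ((f x - phi (rf f) x) ^+ 2 / phi (rf f) x)%:E)%E].
Proof.
have A0 := C1_int_sq_gt0 _ hf; have B0 := C1_int_x2sq_gt0 _ hf.
have r0 : 0 < rf f by rewrite sqrtr_gt0 divr_gt0.
split=> //; first by rewrite sqr_sqrtr// ltW// divr_gt0.
rewrite C1_integral_deviation// -EFinM -EFinD; congr (_%:E).
have sA0 : 0 < Num.sqrt (int_sq f) by rewrite sqrtr_gt0.
have sB0 : 0 < Num.sqrt (int_x2sq f) by rewrite sqrtr_gt0.
rewrite /rf /J sqrtrM ?ltW// sqrtrV ?ltW//.
(* With [a] and [b] the roots of the two integrals, [rf f = a / b] and [J f = a * b]. Since
   [a ^+ 2 / (a / b)] and [(a / b) * b ^+ 2] both equal [a * b], what remains is a rational identity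
   in [a], [b] and [p]. *)
have := sqr_sqrtr (ltW A0); have := sqr_sqrtr (ltW B0).
move: (Num.sqrt (int_sq f)) (Num.sqrt (int_x2sq f)) pi sA0 sB0 (pi_gt0 R).
move=> a b p a0 b0 p0 <- <-.
by field; rewrite !gt_eqF.
Qed.
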